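(* Let $X$ and $I$ be compact metric spaces, let $\{f_t\}_{t\in I}$ be a near-isotopy of $X$ (i.e. a near-isotopy in $\mathcal{C}(X,X)$), and let $F\colon X\times I\to X\times I$, $F(x,t)=(f_t(x),t)$, be the corresponding fat map. Write $X_\infty^t=\varprojlim(X,f_t)$ for $t\in I$, write $(X\times I)_\infty=\varprojlim(X\times I,F)$, let $\iota_t\colon X_\infty^t\to(X\times I)_\infty$ be the embedding $\iota_t(x_0,x_1,\ldots)=((x_0,t),(x_1,t),\ldots)$, and let $\pi_0\colon(X\times I)_\infty\to X\times I$ be projection to the $0^{\text{th}}$ coordinate. Then for all $\epsilon>0$ there exists a homeomorphism $\beta\colon(X\times I)_\infty\to X\times I$ such that (a) $\beta\circ\iota_t(X_\infty^t)=X\times\{t\}$ for all $t\in I$, and (b) $d(\beta,\pi_0)<\epsilon$.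
   Context: For compact metric spaces $X,Y$, $\mathcal{C}(X,Y)$ and $\mathcal{H}(X,Y)$ denote the spaces of continuous maps and of homeomorphisms $X\to Y$, with the uniform metric $d(f,g)=\sup_{x\in X} d(f(x),g(x))$. A family $\{f_t\}_{t\in I}$ in $\mathcal{C}(X,Y)$ is continuous if $t\mapsto f_t$ is continuous for the uniform metric (equivalently, $(x,t)\mapsto f_t(x)$ is continuous). The product $X\times I$ carries a standard product metric, e.g. the maximum metric, so that $d((x,t),(y,t))=d(x,y)$. $\mathbb{N}$ includes $0$. Near-isotopy: a continuous family $\{f_t\}_{t\in I}$ in $\mathcal{C}(X,Y)$, with $I$ a compact metric space, is a near-isotopy if the map $X\times I\to Y$, $(x,t)\mapsto f_t(x)$, can be uniformly approximated (arbitrarily closely) by maps of the form $(x,t)\mapsto h_t(x)$, where $\{h_t\}_{t\in I}$ is a continuous family in $\mathcal{H}(X,Y)$. Inverse limit: for a continuous self-map $f\colon Z\to Z$ of a compact metric space, $\varprojlim(Z,f)=\{\underline{x}=(x_0,x_1,\dots)\in Z^{\mathbb{N}} : f(x_{i+1})=x_i\text{ for all }i\in\mathbb{N}\}$, as a subspace of the product $Z^{\mathbb{N}}$. *)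

(* Defs.v *)
From HB Require Import structures.
From mathcomp Require Import all_boot all_order all_algebra.
From mathcomp Require Import all_classical all_reals all_analysis.

Set Implicit Arguments.
Unset Strict Implicit.
Unset Printing Implicit Defensive.

Import Order.TTheory GRing.Theory Num.Theory.

Local Open Scope classical_set_scope.
Local Open Scope ring_scope.

(* The library makes X * Y a pseudometric space whose balls are products of
   balls; the corresponding distance is the maximum metric. *)
Section prod_metric.
Context {R : realType} {X Y : metricType R}.
Implicit Types p q : X * Y.

Definition prod_mdist p q : R := Num.max (mdist p.1 q.1) (mdist p.2 q.2).

Lemma prod_mdist_ge0 p q : 0 <= prod_mdist p q.
Proof. by rewrite le_max mdist_ge0. Qed.

Lemma prod_mdist_positivity p q : prod_mdist p q = 0 -> p = q.
Proof.
case: p q => [x y] [x' y'] pq0.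
have /andP[x0 y0] : (mdist x x' <= 0) && (mdist y y' <= 0).
  by rewrite -ge_max -[X in _ <= X]pq0.
congr pair; apply: mdist_positivity; apply/eqP.
  by rewrite eq_le x0 mdist_ge0.
by rewrite eq_le y0 mdist_ge0.
Qed.

Lemma prod_ballEmdist p (r : R) : ball p r = [set q | prod_mdist p q < r].
Proof.
apply/seteqP; split=> [q [] | q /=].
  by rewrite !ballEmdist /= gt_max => -> ->.
by rewrite gt_max => /andP[p1 p2]; split; rewrite ballEmdist.
Qed.

HB.instance Definition _ := PseudoMetric_isMetric.Build R (X * Y)%type
  prod_mdist_ge0 prod_mdist_positivity prod_ballEmdist.

End prod_metric.

(* The supremum is taken in \bar R, so that it is +oo for maps that are not
   at bounded distance (it is -oo when the domain is empty). *)
Definition unif_dist {R : realType} {T : Type} {Y : metricType R}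
    (f g : T -> Y) : \bar R :=
  ereal_sup [set (mdist (f x) (g x))%:E | x in [set: T]].

Definition homeomorphism {S T : topologicalType} (f : S -> T) : Prop :=
  continuous f /\
  exists g : T -> S, [/\ continuous g, cancel f g & cancel g f].

Definition unif_metric_continuous {R : realType} {I X Y : metricType R}
    (f : I -> X -> Y) : Prop :=
  forall (t : I) (e : R), 0 < e ->
    \forall s \near t, (unif_dist (f t) (f s) < e%:E)%E.

Definition continuous_family {R : realType} {I X Y : metricType R}
    (f : I -> X -> Y) : Prop :=
  (forall t, continuous (f t)) /\ unif_metric_continuous f.

Definition homeo_family {R : realType} {I X Y : metricType R}
    (h : I -> X -> Y) : Prop :=
  (forall t, homeomorphism (h t)) /\ unif_metric_continuous h.

Definition near_isotopy {R : realType} {I X Y : metricType R}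
    (f : I -> X -> Y) : Prop :=
  continuous_family f /\
  forall e : R, 0 < e -> exists h : I -> X -> Y, homeo_family h /\
    (unif_dist (fun p : X * I => f p.2 p.1) (fun p : X * I => h p.2 p.1)
       < e%:E)%E.

(* Used as a type, this set carries the topology induced by the product
   topology on sequences. *)
Definition invlim {Z : topologicalType} (f : Z -> Z) : set {ptws nat -> Z} :=
  [set x | forall i : nat, f (x i.+1) = x i].

Definition fat_map {X I : Type} (f : I -> X -> X) (p : X * I) : X * I :=
  (f p.2 p.1, p.2).

Definition pi0 {Z : topologicalType} (f : Z -> Z) (x : invlim f) : Z :=
  set_val x 0%N.

Definition iota_seq {X I : topologicalType} (t : I) (x : {ptws nat -> X}) :
  {ptws nat -> (X * I)%type} := fun i => (x i, t).

Lemma iota_seq_invlim {X I : topologicalType} (f : I -> X -> X) (t : I)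
  (x : invlim (f t)) : iota_seq t (set_val x) \in invlim (fat_map f).
Proof.
apply/mem_set => i; rewrite /fat_map /iota_seq /=; congr pair.
exact: (set_mem (svalP x) i).
Qed.

Definition iota_emb {X I : topologicalType} (f : I -> X -> X) (t : I)
    (x : invlim (f t)) : invlim (fat_map f) :=
  exist (fun y => y \in invlim (fat_map f)) _ (iota_seq_invlim x).

(* Main.v *)
(* The fat map F is a uniform limit of fiber-preserving homeomorphisms of
   Z = X * I, so M. Brown's argument applies fiberwise.  Set g_0 = id and
   g_(n+1) = g_n o h_n, with h_n a fiber-preserving homeomorphism so close to F
   that g_(n+1) o pi_(n+1) is close to g_n o F o pi_(n+1) = g_n o pi_n.  The maps
   g_n o pi_n converge uniformly to some beta close to pi_0.  It is surjective,
   because F, hence each pi_n, is surjective and the inverse limit is compact;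
   it is injective because at stage n the remaining perturbations are chosen
   small compared with the modulus of continuity of F^j o g_n^-1 for j <= n. *)
Require Import Defs.
From HB Require Import structures.
From mathcomp Require Import all_boot all_order all_algebra.
From mathcomp Require Import all_classical all_reals all_analysis.
From mathcomp Require Import lra.

Set Implicit Arguments.
Unset Strict Implicit.
Unset Printing Implicit Defensive.

Import Order.TTheory GRing.Theory Num.Theory.

Local Open Scope classical_set_scope.
Local Open Scope ring_scope.

(** * Compactness arguments in metric spaces *)

Lemma continuous_mdist (R : realType) (T : topologicalType) (Y : metricType R)
    (a b : T -> Y) :
  continuous a -> continuous b -> continuous (fun t => mdist (a t) (b t) : R^o).
Proof.
move=> ca cb t; apply/cvgrPdist_lt => d d0.
have d20 : 0 < d / 2 by rewrite divr_gt0.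
have /cvg_ballP/(_ _ d20) na := ca t; have /cvg_ballP/(_ _ d20) nb := cb t.
apply: filterS2 na nb => s; rewrite !ballEmdist /= => ha hb.
have := metric_triangle (a t) (a s) (b t).
have := metric_triangle (a s) (b s) (b t).
have := metric_triangle (a s) (a t) (b s).
have := metric_triangle (a t) (b t) (b s).
rewrite (metric_sym (a s) (a t)) (metric_sym (b s) (b t)) => *.
by rewrite ltr_norml; apply/andP; split; lra.
Qed.

Lemma closed_dense_mem (R : realType) (Y : metricType R) (A : set Y) (z : Y) :
  closed A -> (forall d : R, 0 < d -> exists2 y, A y & mdist z y < d) -> A z.
Proof.
move=> cA hA; apply: cA => B /nbhs_ballP[d /= d0 dB].
have [y Ay zy] := hA d d0.
by exists y; split => //; apply: dB; rewrite ballEmdist.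
Qed.

Lemma compact_surjective (R : realType) (S : topologicalType) (Y : metricType R)
    (f : S -> Y) :
  compact [set: S] -> continuous f ->
  (forall (z : Y) (d : R), 0 < d -> exists x, mdist z (f x) < d) ->
  forall z, exists x, f x = z.
Proof.
move=> cS cf hf z.
suff [x _ <-] : (f @` setT) z by exists x.
apply: closed_dense_mem => [|d /(hf z)[x zx]]; last by exists (f x) => //; exists x.
apply: compact_closed; first exact: metric_hausdorff.
by apply: continuous_compact => //; exact: continuous_subspaceT.
Qed.

Lemma compact_bijective_homeomorphism (S T : topologicalType) (f : S -> T) :
  compact [set: S] -> hausdorff_space T -> continuous f -> injective f ->
  (forall y, exists x, f x = y) -> homeomorphism f.
Proof.
move=> cS hT cf injf /choice[g gK]; split=> //; exists g.
have fK : cancel f g by move=> x; apply: injf; rewrite gK.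
split=> //; apply/continuous_closedP => A clA.
have -> : g @^-1` A = f @` A.
  apply/seteqP; split=> [y Agy | _ [x Ax <-]]; first by exists (g y).
  by rewrite /preimage /= fK.
apply: compact_closed => //; apply: continuous_compact.
  exact: continuous_subspaceT.
exact: subclosed_compact clA cS _.
Qed.

(* With [a] the identity this is uniform continuity of [b]; with [a]
   injective it is a quantitative form of injectivity. *)
Lemma compact_modulus (R : realType) (Z : topologicalType) (A B : metricType R)
    (a : Z -> A) (b : Z -> B) (e : R) :
  compact [set: Z] -> continuous a -> continuous b ->
  (forall z w, a z = a w -> b z = b w) -> 0 < e ->
  \forall d \near 0^'+, forall z w, mdist (a z) (a w) < d ->
    mdist (b z) (b w) < e.
Proof.
move=> cZ ca cb ab e0.
have /compact_near_coveringP cZZ : compact ([set: Z] `*` [set: Z]).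
  exact: compact_setX.
have cd (C : metricType R) (c : Z -> C) : continuous c ->
    continuous (fun p : Z * Z => mdist (c p.1) (c p.2) : R^o).
  move=> cc; apply: continuous_mdist => p; apply: continuous_comp.
  - exact: cvg_fst.
  - exact: cc.
  - exact: cvg_snd.
  - exact: cc.
have : \forall d \near (0 : R)^'+, [set: Z] `*` [set: Z] `<=`
    (fun p => mdist (a p.1) (a p.2) < d -> mdist (b p.1) (b p.2) < e).
  apply: (cZZ R _ (fun d p => mdist (a p.1) (a p.2) < d ->
                              mdist (b p.1) (b p.2) < e)).
  (* Near a pair [p] whose [b]-values are within [e], the conclusion persists for every [d].
     Otherwise the [a]-values at [p] are a distance [r > 0] apart, and near [p] the premise fails
     once [d < r / 2]. *)
  move=> p _; have [lt_be|le_eb] := ltP (mdist (b p.1) (b p.2)) e.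
    exists ([set q | mdist (b q.1) (b q.2) < e], setT) => /=.
      split; last exact: filterT.
      exact: (cvgr_lt _ (cd _ _ cb p)).
    by move=> [q d] [].
  have r0 : 0 < mdist (a p.1) (a p.2).
    rewrite mdist_gt0; apply/eqP => /ab bp.
    by move: (lt_le_trans e0 le_eb); rewrite bp mdistxx ltxx.
  set r := mdist _ _ in r0.
  exists ([set q | r / 2 < mdist (a q.1) (a q.2)], [set d | d < r / 2]) => /=.
    split; first by apply: (cvgr_gt _ (cd _ _ ca p)); rewrite /= -/r; lra.
    by apply: nbhs_right_lt; rewrite divr_gt0.
  by move=> [q d] [/= h1 h2] h3; lra.
apply: filterS => d hd z w; exact: (hd (z, w)).
Qed.

(** * Inverse limits: compactness, projections and limits of sequences *)

Lemma continuous_ptws_proj (Z : topologicalType) (n : nat) :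
  continuous (fun x : {ptws nat -> Z} => x n).
Proof. exact: (@proj_continuous nat (fun=> Z) n). Qed.

Lemma continuous_invlim_proj (Z : topologicalType) (F : Z -> Z) (n : nat) :
  continuous (fun x : invlim F => set_val x n).
Proof.
move=> x.
apply: (@continuous_comp (invlim F) {ptws nat -> Z} Z set_val (fun u => u n) x).
  exact: initial_continuous.
exact: continuous_ptws_proj.
Qed.

Lemma closed_invlim (R : realType) (Z : metricType R) (F : Z -> Z) :
  continuous F -> closed (invlim F).
Proof.
move=> cF.
have -> : invlim F = \bigcap_(i in [set: nat])
    (fun x : {ptws nat -> Z} => mdist (F (x i.+1)) (x i) : R^o) @^-1` [set 0].
  apply/seteqP; split=> [x Fx i _ | x Fx i].
    by rewrite /= Fx mdistxx.
  by apply: mdist_positivity; exact: Fx.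
apply: closed_bigI => i _.
apply: (continuous_closedP _).1; last exact: closed_eq.
apply: continuous_mdist => [x|]; last exact: continuous_ptws_proj.
by apply: continuous_comp; [exact: continuous_ptws_proj | exact: cF].
Qed.

(** A filter on the subtype is pushed forward to [T]. A cluster point of the image in [A] is a
    cluster point upstairs, because open sets of the subtype are preimages of open sets of [T]. *)
Lemma compact_set_type (T : topologicalType) (A : set T) :
  compact A -> compact [set: A].
Proof.
move=> cA F PF _.
have [p [Ap clp]] : (A `&` cluster (@set_val T A @ F)) !=set0.
  apply: (cA (@set_val T A @ F) (fmap_proper_filter _ PF)).
  by apply: (@filterS _ F _ setT _ _ filterT) => x _; exact: (set_valP x).
exists (exist _ p (mem_set Ap)); split=> // B C FB.
move=> [_ [[D oD <-] /= Dp] DC].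
have /clp/(_ (open_nbhs_nbhs (conj oD Dp)))[q [[x Bx xq] Dq]] :
    (@set_val T A @ F) (set_val @` B).
  by apply: (@filterS _ F _ B _ _ FB) => x Bx; exists x.
by exists x; split => //; apply: DC; rewrite /= -xq in Dq.
Qed.

Lemma invlim_compact (R : realType) (Z : metricType R) (F : Z -> Z) :
  compact [set: Z] -> continuous F -> compact [set: invlim F].
Proof.
move=> cZ cF; apply: compact_set_type.
apply: (subclosed_compact (closed_invlim cF)) => [|x _].
  exact: (@tychonoff nat (fun=> Z) (fun=> setT) (fun=> cZ)).
by [].
Qed.

Lemma invlimP (Z : topologicalType) (F : Z -> Z) (x : invlim F) (i : nat) :
  F (set_val x i.+1) = set_val x i.
Proof. exact: (set_valP x i). Qed.

Lemma iter_invlim (Z : topologicalType) (F : Z -> Z) (x : invlim F) (j i : nat) :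
  iter j F (set_val x (j + i)%N) = set_val x i.
Proof. by elim: j => // j IH; rewrite iterSr addSn invlimP. Qed.

Lemma invlim_proj_surjective (Z : topologicalType) (F : Z -> Z) (n : nat) :
  (forall z, exists y, F y = z) ->
  forall z, exists x : invlim F, set_val x n = z.
Proof.
move=> /choice[G GK] z.
(* Coordinates up to [n] are forced by [F]; the later ones are chosen with a right inverse [G] of
   [F]. *)
pose u i := if (i <= n)%N then iter (n - i) F z else iter (i - n) G z.
have uF : invlim F u.
  move=> i; rewrite /u; case: (ltngtP i n) => [lt_in|lt_ni|->].
  - by rewrite -iterS subnSK.
  - by rewrite subSn ?(ltnW lt_ni)//= GK.
  - by rewrite subnn subSn// subnn /= GK.
by exists (exist _ u (mem_set uF)); rewrite set_valE /= /u leqnn subnn.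
Qed.

(** Any cluster point [b] works: it is approached by terms [u m] with [n <= m], all within [r n] of
    [u n]. *)
Lemma compact_limit (R : realType) (Z : metricType R) (u : nat -> Z)
    (r : nat -> R) :
  compact [set: Z] -> (forall n m, (n <= m)%N -> mdist (u m) (u n) <= r n) ->
  exists b, forall n, mdist b (u n) <= r n.
Proof.
move=> cZ hu; have [b [_ clb]] := cZ (u @ \oo) _ filterT.
exists b => n; apply/ler_addgt0Pr => d d0.
have /clb/(_ (nbhsx_ballx b d d0))[_ [[m /= nm <-]]] :
    (u @ \oo) (u @` [set m | (n <= m)%N]) by exists n => // m; exists m.
rewrite ballEmdist /= => bm.
by have := metric_triangle b (u m) (u n); have := hu n m nm; lra.
Qed.

Lemma homeomorphism_id (T : topologicalType) : homeomorphism (@id T).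
Proof. by split; [by move=> ? | exists id; split => // ?]. Qed.

Lemma homeomorphism_comp (S T U : topologicalType) (f : S -> T) (g : T -> U) :
  homeomorphism f -> homeomorphism g -> homeomorphism (g \o f).
Proof.
move=> [cf [f' [cf' fK f'K]]] [cg [g' [cg' gK g'K]]]; split.
  by move=> x; apply: continuous_comp; [exact: cf | exact: cg].
exists (f' \o g'); split; last 2 first.
- exact: can_comp.
- exact: can_comp.
by move=> x; apply: continuous_comp; [exact: cg' | exact: cf'].
Qed.

(** * Brown's approximation argument, preserving the fibers of [q] *)

Section near_homeomorphism.
Context {R : realType} {Z T : metricType R} (q : Z -> T) (F : Z -> Z).
Hypotheses (cZ : compact [set: Z]) (cq : continuous q) (cF : continuous F).
Hypothesis near_homeo : forall e : R, 0 < e -> exists h : Z -> Z,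
  [/\ homeomorphism h, forall z, q (h z) = q z & forall z, mdist (F z) (h z) < e].

(** Fibers of [q] are closed, so preservation of fibers passes to limits, first to [F] and later to
    [beta]. *)
Let fiber_closed (z : Z) (t : T) :
  (forall d : R, 0 < d -> exists2 y, q y = t & mdist z y < d) -> q z = t.
Proof.
apply: (@closed_dense_mem R Z (q @^-1` [set t])).
apply: (continuous_closedP q).1 => //.
exact: (compact_closed (@metric_hausdorff _ T) (@compact_set1 _ t)).
Qed.

Let q_F z : q (F z) = q z.
Proof.
apply: fiber_closed => d d0; have [h [_ qh Fh]] := near_homeo d0.
by exists (h z).
Qed.

Let F_surj z : exists y, F y = z.
Proof.
apply: compact_surjective => // {}z d d0.
have [h [[_ [h' [_ _ h'K]]] _ Fh]] := near_homeo d0.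
by exists (h' z); rewrite metric_sym -{2}[z]h'K.
Qed.

(* By the last clause, a map within [d / 4] of [g \o pi_n] can only identify
   two points of the inverse limit whose coordinates [0, ..., n] are close. *)
Let stage n (g : Z -> Z) (d : R) :=
  [/\ homeomorphism g, forall z, q (g z) = q z, 0 < d, d < n.+1%:R^-1 &
      forall j : 'I_n.+1, forall z w, mdist (g z) (g w) < d ->
        mdist (iter j F z) (iter j F w) < n.+1%:R^-1].

Let stage_exists n g (e : R) : homeomorphism g -> (forall z, q (g z) = q z) ->
  0 < e -> exists2 d, stage n g d & d <= e.
Proof.
move=> hg qg e0; have [cg [g' [_ gK _]]] := hg.
have n0 : 0 < n.+1%:R^-1 :> R by rewrite invr_gt0.
have citer j : continuous (iter j F).
  elim: j => [|j IH]; first by move=> ?.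
  by move=> z; apply: continuous_comp; [exact: IH | exact: cF].
(* Since [g] is injective, [g z] determines each [iter j F z], and does so uniformly by compactness.
   Only finitely many [j] occur, so one [d] serves them all. *)
have sep (j : 'I_n.+1) := compact_modulus cZ cg (citer j)
  (fun z w gzw => congr1 (iter j F) (can_inj gK gzw)) n0.
have [d [d0 dn de hd]] : exists d : R, [/\ 0 < d, d < n.+1%:R^-1, d <= e &
    forall j : 'I_n.+1, forall z w, mdist (g z) (g w) < d ->
        mdist (iter j F z) (iter j F w) < n.+1%:R^-1].
  apply: (@filter_ex _ (0 : R)^'+); near=> d; split.
  - by near: d; exact: nbhs_right_gt.
  - by near: d; exact: nbhs_right_lt.
  - by near: d; exact: nbhs_right_le.
  - by near: d; exact: filter_forall sep.
by exists d.
Unshelve. all: by end_near.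
Qed.

(** The new map is [g \o h], with [h] so close to [F] that uniform continuity of [g] keeps [g \o h]
    within [d / 8] of [g \o F]. *)
Let stage_step n g d : stage n g d -> exists g' d',
  [/\ stage n.+1 g' d', d' <= d / 2 & forall z, mdist (g' z) (g (F z)) <= d / 8].
Proof.
move=> [hg qg d0 _ _]; have [cg _] := hg.
have d80 : 0 < d / 8 by rewrite divr_gt0.
have [c [c0 hc]] : exists c : R, 0 < c /\
    forall z w, mdist z w < c -> mdist (g z) (g w) < d / 8.
  apply: (@filter_ex _ (0 : R)^'+); near=> c; split.
    by near: c; exact: nbhs_right_gt.
  near: c; apply: (@compact_modulus R Z Z Z id g) => //.
    by move=> ?.
  by move=> z w /= ->.
have [h [hh qh Fh]] := near_homeo c0.
have [||| d' hd' d'd] := @stage_exists n.+1 (g \o h) (d / 2).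
- exact: homeomorphism_comp.
- by move=> z /=; rewrite qg qh.
- by rewrite divr_gt0.
exists (g \o h), d'; split=> // z.
by apply/ltW/hc; rewrite metric_sym.
Unshelve. all: by end_near.
Qed.

Let stage_sequence (e : R) : 0 < e -> exists (g : nat -> Z -> Z) (d : nat -> R),
  [/\ g 0%N = id, d 0%N <= e, forall n, stage n (g n) (d n),
      forall n, d n.+1 <= d n / 2 &
      forall n z, mdist (g n.+1 z) (g n (F z)) <= d n / 8].
Proof.
move=> e0.
have [d00 s0 d0e] := @stage_exists 0%N id e (@homeomorphism_id Z) (fun=> erefl) e0.
(* The index is stored in the state because [stage] depends on it; [un] below identifies it with the
   position in the sequence. *)
pose St := {s : nat * (Z -> Z) * R | stage s.1.1 s.1.2 s.2}.
pose next (s s' : St) := [/\ (sval s').1.1 = (sval s).1.1.+1,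
  (sval s').2 <= (sval s).2 / 2 &
  forall z, mdist ((sval s').1.2 z) ((sval s).1.2 (F z)) <= (sval s).2 / 8].
have [s|u [u0 uS]] := @dependent_choice St next _ (exist _ (0%N, id, d00) s0).
  apply: cid; case: s => -[[n g] d] /= hs.
  have [g' [d' [hs' d'd gg']]] := stage_step hs.
  by exists (exist _ (n.+1, g', d') hs').
have un n : (sval (u n)).1.1 = n.
  by elim: n => [|n IH]; [rewrite u0 | have [-> _ _] := uS n; rewrite IH].
exists (fun n => (sval (u n)).1.2), (fun n => (sval (u n)).2).
split=> [||n|n|n]; first by rewrite u0.
- by rewrite u0.
- by have := svalP (u n); rewrite un.
- by have [] := uS n.
- by have [] := uS n.
Qed.

(* [q] plays the role of the projection to the parameter space. *)
Lemma invlim_near_homeomorphism (e : R) : 0 < e ->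
  exists beta : invlim F -> Z, [/\ homeomorphism beta,
    forall x, q (beta x) = q (pi0 x) & forall x, mdist (beta x) (pi0 x) <= e].
Proof.
move=> e0; have [g [d [g0 d0e hs dS gS]]] := stage_sequence e0.
pose b n (x : invlim F) := g n (set_val x n).
have d_gt0 n : 0 < d n by have [] := hs n.
have bS n x : mdist (b n.+1 x) (b n x) <= d n / 8.
  by rewrite /b -(invlimP x n).
(* The bound reproduces itself: [d n / 8 + d n.+1 / 4 <= d n / 8 + d n / 8]. *)
have bD k n x : mdist (b (k + n)%N x) (b n x) <= d n / 4.
  elim: k n => [|k IH] n; first by rewrite mdistxx divr_ge0// ltW.
  have := metric_triangle (b (k + n.+1)%N x) (b n.+1 x) (b n x).
  rewrite addSnnS; have := IH n.+1; have := bS n x; have := dS n; lra.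
have /choice[beta betaP] : forall x, exists y, forall n,
    mdist y (b n x) <= d n / 4.
  move=> x; apply: (@compact_limit R Z (b ^~ x) (fun n => d n / 4)) => // n m nm.
  by rewrite -(subnK nm).
have smalld r : 0 < r -> exists n, d n < r.
  move=> r0; have [n _ nr] := near_infty_natSinv_lt (PosNum r0).
  by exists n; have [_ _ _ dn _] := hs n; apply: lt_trans dn (nr n _) => /=.
have cb n : continuous (b n).
  have [[cg _] _ _ _ _] := hs n.
  by move=> x; apply: continuous_comp; [exact: continuous_invlim_proj | exact: cg].
have qproj n (x : invlim F) : q (set_val x n) = q (pi0 x).
  by elim: n => // n IH; rewrite -IH -[LHS]q_F invlimP.
have cL : compact [set: invlim F] by exact: invlim_compact.
exists beta; split.
(* [beta] is a uniform limit of the continuous maps [b n]. *)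
- have cbeta : continuous beta.
    move=> x; apply/(@cvg_ballP _ _ _ (nbhs x)) => r r0.
    have r20 : 0 < r / 2 by rewrite divr_gt0.
    have [n dn] := smalld _ r20; have /(@cvg_ballP _ _ _ (nbhs x))/(_ _ r20) := cb n x.
    apply: filterS => y; rewrite !ballEmdist /= => bxy.
    have := metric_triangle (beta x) (b n x) (beta y).
    have := metric_triangle (b n x) (b n y) (beta y).
    rewrite (metric_sym (b n y) (beta y)).
    by have := betaP x n; have := betaP y n; have := d_gt0 n; lra.
  apply: compact_bijective_homeomorphism => //; first exact: metric_hausdorff.
  (* If the [i]-th coordinates were [r > 0] apart, take [n >= i] with [n.+1%:R^-1 < r]. Equality
     under [beta] puts [b n x] and [b n y] within [d n / 2], so the separation clause for
     [j = n - i] brings the [i]-th coordinates closer than [r]. *)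
  + move=> x y bxy; apply: val_inj; apply/funext => i.
    rewrite -!set_valE; apply/eqP; apply: contraT; rewrite -mdist_gt0 => r0.
    have [N _ hN] := near_infty_natSinv_lt (PosNum r0).
    pose n := maxn N i; have /= nr := hN n (leq_maxl _ _).
    have lei : (n - i < n.+1)%N by rewrite ltnS leq_subr.
    have proji (w : invlim F) : iter (n - i) F (set_val w n) = set_val w i.
      by rewrite -{2}(subnK (leq_maxr N i : (i <= n)%N)) iter_invlim.
    have [_ _ _ _ /(_ (Ordinal lei) (set_val x n) (set_val y n))] := hs n.
    rewrite /= !proji => sep; have : mdist (b n x) (b n y) < d n.
      have := metric_triangle (b n x) (beta x) (b n y).
      rewrite (metric_sym (b n x) (beta x)) {2}bxy.
      by have := betaP x n; have := betaP y n; have := d_gt0 n; lra.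
    by move=> /sep/lt_trans/(_ nr); rewrite ltxx.
  (* Dense range suffices: a point whose [n]-th coordinate is the [g n]-preimage of [z] has
     [b n x = z], hence [beta x] within [d n / 4] of [z]. *)
  + apply: compact_surjective => // z r /smalld[n dn].
    have [[_ [g' [_ _ g'K]]] _ _ _ _] := hs n.
    have [x xn] := invlim_proj_surjective n F_surj (g' z).
    exists x; have := betaP x n; rewrite /b xn g'K metric_sym.
    by have := d_gt0 n; lra.
- move=> x; apply: fiber_closed => r /smalld[n dn]; exists (b n x).
    by have [_ qg _ _ _] := hs n; rewrite /b qg qproj.
  by have := betaP x n; have := d_gt0 n; lra.
- by move=> x; have := betaP x 0%N; rewrite /b g0 /pi0 /=; have := d_gt0 0%N; lra.
Qed.
End near_homeomorphism.

(** * Fat maps and the application to near-isotopies *)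

Lemma unif_dist_lt (R : realType) (T : Type) (Y : metricType R) (f g : T -> Y)
    (e : R) :
  (unif_dist f g < e%:E)%E -> forall x, mdist (f x) (g x) < e.
Proof.
move=> fg x; rewrite -lte_fin; apply: le_lt_trans fg.
by apply: ereal_sup_ubound; exists x.
Qed.

Lemma fat_map_continuous (R : realType) (I X : metricType R)
    (f : I -> X -> X) : continuous_family f -> continuous (fat_map f).
Proof.
move=> [cf uf] [x t]; apply: cvg_pair => /=; last exact: cvg_snd.
apply/cvg_ballP => e e0; have e20 : 0 < e / 2 by rewrite divr_gt0.
have /cvg_ballP/(_ _ e20) nx := cf t x; have nt := uf t _ e20.
exists ([set y | ball (f t x) (e / 2) (f t y)],
        [set s | (unif_dist (f t) (f s) < (e / 2)%:E)%E]) => //.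
move=> [y s] [/= xy /unif_dist_lt/(_ y) ts]; move: xy; rewrite !ballEmdist /=.
by have := metric_triangle (f t x) (f t y) (f s y); lra.
Qed.

(** Compactness supplies the joint continuity of the inverses: a continuous bijection of [X * I] is
    enough. *)
Lemma fat_map_homeomorphism (R : realType) (I X : metricType R)
    (h : I -> X -> X) :
  compact [set: X] -> compact [set: I] -> homeo_family h ->
  homeomorphism (fat_map h).
Proof.
move=> cX cI [hh uh].
apply: compact_bijective_homeomorphism.
- by rewrite -setXTT; exact: compact_setX.
- exact: (@metric_hausdorff R (X * I)%type).
- by apply: fat_map_continuous; split=> // t; have [] := hh t.
- move=> [x t] [y s] [/= + ts]; rewrite -{}ts => hxy; congr pair.
  by have [_ [g [_ gK _]]] := hh t; exact: can_inj hxy.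
- by move=> [y t]; have [_ [g [_ _ gK]]] := hh t; exists (g y, t); rewrite /fat_map /= gK.
Qed.

Theorem theorem2p2 (R : realType) (X I : metricType R)
    (cX : compact [set: X]) (cI : compact [set: I])
    (f : I -> X -> X) (hf : near_isotopy f)
    (e : R) (e0 : 0 < e) :
  exists beta : invlim (fat_map f) -> X * I,
    [/\ homeomorphism beta,
        forall t : I,
          (beta \o @iota_emb X I f t) @` [set: invlim (f t)]
            = [set: X] `*` [set t]
      & (unif_dist beta (@pi0 _ (fat_map f)) < e%:E)%E].
Proof.
have [cf nf] := hf.
have cZ : compact [set: X * I] by rewrite -setXTT; exact: compact_setX.
have near_homeo d : 0 < d -> exists h : X * I -> X * I, [/\ homeomorphism h,
    forall z, (h z).2 = z.2 & forall z, mdist (fat_map f z) (h z) < d].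
  move=> d0; have [h [hh /unif_dist_lt fh]] := nf d d0.
  exists (fat_map h); split=> // [|z]; first exact: fat_map_homeomorphism.
  by rewrite -[mdist _ _]/(prod_mdist _ _) gt_max /= mdistxx d0 andbT.
have csnd : continuous (@snd X I) by move=> z; exact: cvg_snd.
(* A pointwise bound by [e / 2] keeps the supremum strictly below [e]. *)
have e20 : 0 < e / 2 by rewrite divr_gt0.
have [beta [hbeta betaq betad]] :=
  invlim_near_homeomorphism cZ csnd (fat_map_continuous cf) near_homeo e20.
exists beta; split=> // [t|]; last first.
  apply: (@le_lt_trans _ _ (e / 2)%:E); last by rewrite lte_fin; lra.
  by apply: ge_ereal_sup => _ [x _ <-]; rewrite lee_fin.
apply/seteqP; split=> [_ [x _ <-] | [x s] [_ /= ->]].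
  by split=> //; rewrite /= betaq.
have [_ [g [_ _ gK]]] := hbeta.
(* The preimage of [(x, t)] lies over [t] in coordinate 0 by [betaq], hence in every coordinate
   since the fat map fixes the parameter. Its first components then form a point of the inverse
   limit of [f t]. *)
pose u := g (x, t).
have ut i : (set_val u i).2 = t.
  elim: i => [|i IH]; first by rewrite -[LHS]betaq gK.
  by rewrite -IH -(invlimP u i).
have u1 : invlim (f t) (fun i => (set_val u i).1).
  by move=> i; rewrite -(invlimP u i) /fat_map /= ut.
exists (exist (fun y => y \in invlim (f t)) _ (mem_set u1)) => //=; rewrite -(gK (x, t)); congr beta.
apply: val_inj; apply/funext => i /=.
by rewrite /iota_seq set_valE -/u [RHS]surjective_pairing -[in RHS]set_valE ut.
Qed.
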